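(* Let $r,p,n$ be positive integers with $p\mid r$, let $m\ge 0$ be an integer, and put $k=\frac{m}{r}$ (a rational number). (1) If $r$ is odd, then the number of involutions $\pi\in G_{r,p,n}$ with $\mathrm{exc}^{\mathrm{Clr}}(\pi)=m$ is $$k!\binom{n}{k,\ k,\ n-2k}\left(\frac{r}{2}\right)^k .$$ (2) If $r$ is even and $p\mid \frac r2$, then the number of involutions $\pi\in G_{r,p,n}$ with $\mathrm{exc}^{\mathrm{Clr}}(\pi)=m$ is $$\sum_{j=\lceil n/2\rceil}^{n}(n-j)!\binom{n}{n-j,\ n-j,\ n-2k,\ 2k-2n+2j}\left(\frac{r}{2}\right)^{n-j}.$$
   Context: Let $\Sigma=\{i^{[c]} : 1\le i\le n,\ c\in\mathbb{Z}_r\}$ be the set $[n]=\{1,\dots,n\}$ coloured with colours $0,1,\dots,r-1$; write $i$ for $i^{[0]}$. The group $G_{r,n}=\mathbb{Z}_r\wr S_n$ of coloured permutations consists, under composition, of all bijections $\sigma:\Sigma\to\Sigma$ for which there are a permutation $|\sigma|\in S_n$ and integers $z_1(\sigma),\dots,z_n(\sigma)\in\{0,\dots,r-1\}$ with $\sigma(i^{[c]})=(|\sigma|(i))^{[c+z_i(\sigma)]}$ (colours added modulo $r$). Put $\mathrm{csum}(\sigma)=\sum_{i=1}^n z_i(\sigma)$, an integer. For $p\mid r$, $G_{r,p,n}=\{\sigma\in G_{r,n} : \mathrm{csum}(\sigma)\equiv 0 \bmod p\}$. An element $\pi$ is an involution if $\pi^2=1$ (the identity included). The colour order on $\Sigma$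 is $1^{[r-1]}<\cdots<n^{[r-1]}<1^{[r-2]}<\cdots<n^{[r-2]}<\cdots<1<\cdots<n$. Define $\mathrm{exc}_A(\sigma)=|\{i\in[n-1] : \sigma(i)>i\}|$ (comparison in the colour order) and $\mathrm{exc}^{\mathrm{Clr}}(\sigma)=r\cdot\mathrm{exc}_A(\sigma)+\mathrm{csum}(\sigma)$. A multinomial coefficient $\binom{n}{a_1,\dots,a_s}=\frac{n!}{a_1!\cdots a_s!}$ (with $a_1+\dots+a_s=n$) is $0$ if some $a_i$ is not a nonnegative integer, and any product containing such a vanishing coefficient is understood to be $0$. *)

(* Defs.v *)
From mathcomp Require Import all_boot all_order all_algebra all_fingroup.

Set Implicit Arguments.
Unset Strict Implicit.
Unset Printing Implicit Defensive.

Import Order.TTheory GRing.Theory Num.Theory.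

(* For r > 0 this is 'I_r, as the additive group of integers modulo r; the
   notation 'Z_r is unsuitable because 'Z_1 has two elements. *)
Definition colour (r : nat) := 'I_r.-1.+1.

(* (i, c) stands for (i+1)^[c]: ordinals are numbered from 0. *)
Notation coloured r n := ('I_n * colour r)%type.

Definition G_rn (r n : nat) : {set {perm coloured r n}} :=
  [set s : {perm coloured r n} |
    [exists t : {perm 'I_n}, exists z : {ffun 'I_n -> colour r},
       forall i, forall c, s (i, c) == (t i, (c + z i)%R)]].

(* z_i(s), read off from s(i^[0]) = |s|(i)^[z_i(s)]. *)
Definition colour_at (r n : nat) (s : {perm coloured r n}) (i : 'I_n) : nat :=
  (s (i, 0%R)).2.

Definition csum (r n : nat) (s : {perm coloured r n}) : nat :=
  \sum_(i < n) colour_at s i.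

Definition G_rpn (r p n : nat) : {set {perm coloured r n}} :=
  [set s in G_rn r n | csum s == 0 %[mod p]].

Definition colour_lt (r n : nat) (x y : coloured r n) : bool :=
  (y.2 < x.2)%N || ((x.2 == y.2) && (x.1 < y.1)%N).

(* With ordinals numbered from 0, i in [n-1] reads i.+1 < n. *)
Definition exc_A (r n : nat) (s : {perm coloured r n}) : nat :=
  #|[set i : 'I_n | (i.+1 < n) && colour_lt (i, 0%R) (s (i, 0%R))]|.

Definition exc_Clr (r n : nat) (s : {perm coloured r n}) : nat :=
  r * exc_A s + csum s.

Definition is_invol (r n : nat) (s : {perm coloured r n}) : bool :=
  (s ^+ 2 == 1)%g.

Definition invol_exc (r p n m : nat) : {set {perm coloured r n}} :=
  [set s in G_rpn r p n | is_invol s && (exc_Clr s == m)].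

(* The lower entries are rational numbers; the coefficient is 0 as soon as one
   of them is not a nonnegative integer. *)
Definition multinom (n : nat) (a : seq rat) : rat :=
  (if all (fun x => x \is a Num.nat) a
   then n`!%:R / \prod_(x <- a) (Num.truncn x)`!%:R else 0)%R.

(* Main.v *)
Require Import Defs.
From mathcomp Require Import all_boot all_order all_algebra all_fingroup.
From mathcomp Require Import zify ring.

Import Order.TTheory GRing.Theory Num.Theory.
Local Open Scope ring_scope.

(* An involution of G_{r,n} is an involution t of [n] together with colours
   satisfying z_i + z_{t(i)} = 0 mod r. A 2-cycle of t contributes r to
   exc^Clr (through exc_A when its colours vanish, through csum otherwise), and
   a fixed point contributes 0, or r/2 when r is even and its colour is r/2.
   With l 2-cycles and f coloured fixed points, exc^Clr = r l + (r/2) f; there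
   are r^l C(n - 2l, f) such colourings of a given t. The number J(l) of
   involutions with l 2-cycles follows from removing a marked 2-cycle:
   (2l + 2) J(l + 1) = (n - 2l) (n - 2l - 1) J(l). *)

(** * Cardinalities through bijections and dependent pairs *)

Lemma card_in_bij {T U : finType} (A : {set T}) (B : {set U})
    (f : T -> U) (g : U -> T) :
  {in A, forall x, f x \in B} -> {in B, forall y, g y \in A} ->
  {in A, cancel f g} -> {in B, cancel g f} -> #|A| = #|B|.
Proof.
move=> fB gA fK gK; apply/eqP; rewrite eqn_leq; apply/andP; split.
  rewrite -(card_in_imset (can_in_inj fK)); apply: subset_leq_card.
  by apply/subsetP => _ /imsetP[x xA ->]; apply: fB.
rewrite -(card_in_imset (can_in_inj gK)); apply: subset_leq_card.
by apply/subsetP => _ /imsetP[x xA ->]; apply: gA.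
Qed.

Lemma card_sigma_set {T U : finType} (A : {set T}) (F : T -> {set U}) :
  #|[set u : T * U | (u.1 \in A) && (u.2 \in F u.1)]| = (\sum_(x in A) #|F x|)%N.
Proof.
rewrite -sum1_card (eq_bigl (fun u : T * U => (u.1 \in A) && (u.2 \in F u.1))).
  rewrite -(pair_big_dep (mem A) (fun x y => y \in F x) (fun _ _ => 1%N)) /=.
  by apply: eq_bigr => x _; rewrite sum1_card.
by move=> u; rewrite inE.
Qed.

(** * Involutions of a finite set, by number of moved points *)

Section Involutions.

Variable T : finType.
Implicit Types (t : {perm T}) (i j x : T).

Definition displaced t : {set T} := [set x | t x != x].

(** The index counts moved points, so [involutions l.*2] collects the involutions with [l]
    2-cycles. *)
Definition involutions (d : nat) : {set {perm T}} :=
  [set t | (t ^+ 2 == 1)%g && (#|displaced t| == d)].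

Lemma involP t : reflect (forall x, t (t x) = x) (t ^+ 2 == 1)%g.
Proof.
apply: (iffP eqP) => [t2 x | tt].
  by rewrite -permM -[(t * t)%g]/(t ^+ 2)%g t2 perm1.
by apply/permP => x; rewrite expgS expg1 permM perm1.
Qed.

Section AddCycle.

Variables (t : {perm T}) (i j : T).
Hypotheses (ti : t i = i) (tj : t j = j) (ij : i != j).

Let s := (tperm i j * t)%g.

Lemma add_cycleL : s i = j.
Proof. by rewrite permM tpermL. Qed.

Lemma add_cycleR : s j = i.
Proof. by rewrite permM tpermR. Qed.

Lemma add_cycleD x : i != x -> j != x -> s x = t x.
Proof. by move=> ix jx; rewrite permM tpermD. Qed.

(** Being injective and fixing [i] and [j], [t] sends no other point to them; so [s] and [t] agree
    along orbits outside these two points, and on them both squares are the identity. *)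
Lemma invol_add_cycle : ((s ^+ 2 == 1) = (t ^+ 2 == 1))%g.
Proof.
have stab y x : t y = y -> y != x -> y != t x.
  by move=> ty; apply: contraNneq => e; apply/eqP/(@perm_inj _ t); rewrite ty.
apply/involP/involP => H x.
  have [<-|ix] := eqVneq i x; first by rewrite !ti.
  have [<-|jx] := eqVneq j x; first by rewrite !tj.
  by have := H x; rewrite (add_cycleD x) // add_cycleD // stab.
have [<-|ix] := eqVneq i x; first by rewrite add_cycleL add_cycleR.
have [<-|jx] := eqVneq j x; first by rewrite add_cycleR add_cycleL.
by rewrite (add_cycleD x) // add_cycleD // stab.
Qed.

Lemma card_displaced_add_cycle : #|displaced s| = #|displaced t|.+2.
Proof.
have -> : displaced s = i |: (j |: displaced t).
  apply/setP => x; rewrite !inE.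
  have [->|xi] := eqVneq x i; first by rewrite add_cycleL eq_sym.
  have [->|xj] := eqVneq x j; first by rewrite add_cycleR ij.
  by rewrite add_cycleD // eq_sym.
by rewrite !cardsU1 !inE ti tj (negbTE ij) !eqxx.
Qed.

End AddCycle.

Lemma displaced1 t : (#|displaced t| == 0%N) = (t == 1%g).
Proof.
rewrite cards_eq0; apply/eqP/eqP => [t0|->].
  apply/permP => x; rewrite perm1; apply/eqP; apply: negbNE.
  by have := in_set0 x; rewrite -t0 inE => ->.
by apply/setP => x; rewrite !inE perm1 eqxx.
Qed.

Lemma card_involutions0 : #|involutions 0| = 1%N.
Proof.
rewrite -[RHS](cards1 (1%g : {perm T})); apply: eq_card => t; rewrite !inE.
rewrite displaced1; case: (eqVneq t 1%g) => [->|_]; rewrite ?andbF //.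
by rewrite expg1n eqxx.
Qed.

(** Both sides count marked involutions: the mark is a moved point [i] on the left, an ordered pair
    of distinct fixed points on the right. Deleting the cycle through [i] and recording [(i, t i)]
    is a bijection. *)
Lemma card_involutionsSS d :
  (#|involutions d.+2| * d.+2 =
   #|involutions d| * ((#|T| - d) * (#|T| - d).-1))%N.
Proof.
pose F t := [set v : T * T | (v.1 \in ~: displaced t) &&
                             (v.2 \in ~: displaced t :\ v.1)].
have cF t : t \in involutions d -> #|F t| = ((#|T| - d) * (#|T| - d).-1)%N.
  rewrite inE => /andP[_ /eqP td].
  rewrite (card_sigma_set (~: displaced t) (fun x => ~: displaced t :\ x)).
  have cC : #|~: displaced t| = (#|T| - d)%N by rewrite -td cardsCs setCK.
  rewrite (eq_bigr (fun=> (#|T| - d).-1)) ?sum_nat_const ?cC // => x xF.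
  by rewrite (cardsD1 x) xF in cC; rewrite -cC.
pose A := [set u : {perm T} * T |
            (u.1 \in involutions d.+2) && (u.2 \in displaced u.1)].
pose B := [set v : {perm T} * (T * T) |
            (v.1 \in involutions d) && (v.2 \in F v.1)].
have -> : (#|involutions d.+2| * d.+2)%N = #|A|.
  rewrite card_sigma_set -sum_nat_const; apply: eq_bigr => t.
  by rewrite inE => /andP[_ /eqP].
have -> : (#|involutions d| * ((#|T| - d) * (#|T| - d).-1))%N = #|B|.
  rewrite card_sigma_set -sum_nat_const.
  by apply: eq_bigr => t /cF.
(* A transposition squares to 1, so the same left product deletes the cycle in [f] and restores it
   in [g]. *)
pose f (u : {perm T} * T) :=
  ((tperm u.2 (u.1 u.2) * u.1)%g, (u.2, u.1 u.2)).
pose g (v : {perm T} * (T * T)) := ((tperm v.2.1 v.2.2 * v.1)%g, v.2.1).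
have tpK i j t : (tperm i j * (tperm i j * t) = t)%g.
  by rewrite mulgA tperm2 mul1g.
apply: (@card_in_bij _ _ A B f g).
- case=> t i; rewrite !inE /= => /andP[/andP[t2 td] tid].
  set s := (_ * t)%g; have tt := involP _ t2.
  have si : s i = i by rewrite permM tpermL tt.
  have sj : s (t i) = t i by rewrite permM tpermR.
  have ij : i != t i by rewrite eq_sym.
  (* Rewriting [t] as the cycle put back onto [s], which fixes [i] and [t i], makes the add-cycle
     lemmas describe a deletion. *)
  move: t2 td; rewrite -{1 2}(tpK i (t i) t) -/s invol_add_cycle //.
  by rewrite card_displaced_add_cycle // !eqSS si sj !eqxx tid /= => -> ->.
- case=> t [i j]; rewrite !inE /= !negbK => /andP[/andP[t2 td]].
  case/andP=> /eqP ti /andP[ji /eqP tj]; have ij : i != j by rewrite eq_sym.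
  by rewrite invol_add_cycle // t2 card_displaced_add_cycle // !eqSS td add_cycleL.
- by case=> t i _; rewrite /g /= tpK.
case=> t [i j]; rewrite !inE /= !negbK => /andP[_ /andP[_ /andP[_ /eqP tj]]].
by rewrite /f /g /= add_cycleL // tpK.
Qed.

Lemma card_involutions l : (l.*2 <= #|T|)%N ->
  (#|involutions l.*2| * (2 ^ l * l`! * (#|T| - l.*2)`!) = #|T|`!)%N.
Proof.
elim: l => [|l IHl] lT; first by rewrite card_involutions0 subn0 !mul1n.
rewrite doubleS in lT *; rewrite -IHl; last by lia.
(* With [e] points fixed after [l + 1] cycles, [factS] splits off [e.+2] and [e.+1], the two factors
   of the recurrence. *)
have [e [e1 e2]] : exists e, (#|T| - l.*2 = e.+2 /\ #|T| - l.*2.+2 = e)%N.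
  by exists (#|T| - l.*2.+2)%N; lia.
have := card_involutionsSS l.*2; rewrite e1 e2 !factS expnS /= => Jrec.
set J := #|_| in Jrec *; transitivity (J * l.*2.+2 * (2 ^ l * l`! * e`!))%N.
  by rewrite -muln2 -[(l * 2).+2]/(2 + l * 2)%N -mulSn; ring.
by rewrite Jrec; ring.
Qed.

End Involutions.

Arguments displaced {T} t.
Arguments involutions {T} d.
Arguments involP {T t}.

(** * Colourings of a fixed involution *)

Section Colourings.

Variables (n : nat) (A : finZmodType) (t : {perm 'I_n}).
Implicit Types (i : 'I_n) (z : {ffun 'I_n -> A}) (S : {set 'I_n}).

(** For an involution these are the smaller points of the 2-cycles. *)
Definition ascents : {set 'I_n} := [set i : 'I_n | (i < t i)%N].

Definition order2 : {set A} := [set c | (c != 0) && (c + c == 0)].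

(** When [t] is an involution, this is what makes the coloured permutation built from [t] and [z] an
    involution. *)
Definition alternating z : bool := [forall i, z i + z (t i) == 0].

Definition coloured_fixpoints z : {set 'I_n} :=
  [set i | (t i == i) && (z i != 0)].

Hypothesis t2 : (t ^+ 2 == 1)%g.

Lemma card_displaced_ascents : #|displaced t| = #|ascents|.*2.
Proof.
have tt := involP t2.
have -> : displaced t = ascents :|: t @: ascents.
  apply/setP => i; rewrite !inE -val_eqE neq_ltn orbC; congr (_ || _).
  apply/idP/imsetP => [ti|[j]]; first by exists (t i); rewrite ?inE ?tt.
  by rewrite inE => jt ->; rewrite tt.
rewrite cardsU card_imset; last exact: perm_inj.
rewrite (_ : _ :&: _ = set0) ?cards0 ?subn0 ?addnn //.
apply/setP => i; rewrite !inE; apply/andP => -[it /imsetP[j]].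
by rewrite inE => jt ij; move: it; rewrite ij tt ltnNge ltnW.
Qed.

(** In a 2-cycle the colour of the smaller point is free and forces that of the larger one; a point
    of [S] takes a colour of order 2, any other fixed point the colour 0. *)
Lemma card_alternating S : S \subset ~: displaced t ->
  #|[set z | alternating z && (coloured_fixpoints z == S)]|
  = (#|A| ^ #|ascents| * #|order2| ^ #|S|)%N.
Proof.
move=> SF; have tt := involP t2.
have fixS i : i \in S -> t i = i.
  by move/(subsetP SF); rewrite !inE negbK => /eqP.
(* Colours allowed once the larger point of each 2-cycle is reset to 0; the last case covers these
   points and the fixed points outside [S]. *)
pose F i : {set A} :=
  if (i < t i)%N then setT else if i \in S then order2 else [set 0].
have -> : (#|A| ^ #|ascents| * #|order2| ^ #|S|)%N
          = #|[set w : {ffun 'I_n -> A} | w \in family F]|.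
  rewrite [RHS]cardsE; transitivity (foldr muln 1%N [seq #|F i| | i : 'I_n]);
    last first.
    rewrite -(card_family (fun i => mem (F i))); apply: eq_card => w.
    by rewrite !inE; apply: eq_forallb.
  rewrite foldrE big_image /=.
  rewrite (bigID (mem ascents)) /= -!prod_nat_const; congr (_ * _)%N.
    by apply: eq_bigr => i; rewrite inE /F => ->; rewrite cardsT.
  rewrite [RHS](bigID (mem S)) /= [X in (_ * X)%N]big1 ?muln1 => [|i].
    apply: eq_big => [i|i iS]; last by rewrite /F iS fixS // ltnn.
    by rewrite inE; case: (boolP (i \in S)) => [/fixS ->|]; rewrite ?ltnn ?andbF.
  by rewrite inE /F => /andP[/negbTE -> /negbTE ->]; rewrite cards1.
(* [f] erases the colour of each larger point; [g] recovers it as the opposite of its partner's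
   colour. *)
pose f z : {ffun 'I_n -> A} := [ffun i => if (t i < i)%N then 0 else z i].
pose g z : {ffun 'I_n -> A} := [ffun i => if (t i < i)%N then - z (t i) else z i].
apply: (@card_in_bij _ _ _ _ f g) => [z|w|z|w]; rewrite inE.
- case/andP=> /forallP alt /eqP zS; rewrite inE; apply/familyP => i.
  rewrite ffunE /F; case: ltngtP => [||/val_inj ti]; rewrite ?in_setT //.
    move=> ti; case: ifP => [/fixS it|_]; last by rewrite inE.
    by rewrite it ltnn in ti.
  have := alt i; rewrite ti -zS !inE ti eqxx /=.
  by case: (eqVneq (z i) 0) => [->|z0] zz; rewrite !inE // z0.
- move/familyP => wF; rewrite inE; apply/andP; split.
    apply/forallP => i; rewrite !ffunE tt.
    case: (ltngtP (t i) i) => [||/val_inj ti]; rewrite ?addNr ?subrr //.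
    have := wF i; rewrite /F ti ltnn.
    by case: ifP => _; rewrite !inE; [case/andP | move/eqP=> ->; rewrite addr0].
  apply/eqP/setP => i; rewrite !inE ffunE; case: eqP => [ti|ti] /=.
    have := wF i; rewrite /F ti ltnn.
    by case: ifP => _; rewrite !inE; [case/andP | move/eqP=> ->; rewrite eqxx].
  by apply/esym/negbTE/negP => /fixS.
- case/andP=> /forallP alt _; apply/ffunP => i; rewrite !ffunE tt.
  case: (ltngtP (t i) i) => // ti.
  by apply/eqP; rewrite eq_sym -subr_eq0 opprK alt.
move/familyP => wF; apply/ffunP => i; rewrite !ffunE.
case: ltnP => // ti; have := wF i; rewrite /F ltnNge ltnW //=.
case: ifP => [/fixS it|_]; first by rewrite it ltnn in ti.
by rewrite inE => /eqP ->.
Qed.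

(** The count for a given [S] depends only on its size, and [S] ranges over the [f]-subsets of the
    fixed points. *)
Lemma card_alternating_draws f :
  #|[set z | alternating z && (#|coloured_fixpoints z| == f)]|
  = (#|A| ^ #|ascents| * ('C(n - #|ascents|.*2, f) * #|order2| ^ f))%N.
Proof.
pose P S := (S \subset ~: displaced t) && (#|S| == f).
rewrite -sum1_card (partition_big coloured_fixpoints P) => [|z]; last first.
  rewrite inE => /andP[_ zf]; rewrite /P zf andbT; apply/subsetP => i.
  by rewrite !inE negbK => /andP[].
rewrite (eq_bigr (fun=> #|A| ^ #|ascents| * #|order2| ^ f)%N).
  rewrite sum_nat_cond_const.
  have -> : #|[set S | P S]| = 'C(n - #|ascents|.*2, f).
    rewrite cards_draws -card_displaced_ascents; congr 'C(_, _).
    by rewrite cardsCs setCK card_ord.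
  by rewrite mulnCA.
move=> S /andP[SF /eqP Sf]; rewrite -[in RHS]Sf -card_alternating // -sum1_card.
apply: eq_bigl => z; rewrite !inE -andbA; congr (_ && _).
by case: (_ =P S) => [->|_]; rewrite ?andbF // Sf eqxx.
Qed.

End Colourings.

Arguments ascents {n} t.
Arguments alternating {n A} t z.
Arguments coloured_fixpoints {n A} t z.
Arguments card_alternating_draws {n} A {t} t2 f.

(** * Coloured involutions and their coloured excedance *)

Section ColouredInvolutions.

Variables (r n : nat).
Hypothesis hr : (0 < r)%N.
Implicit Types (c d : colour r) (t : {perm 'I_n}) (z : {ffun 'I_n -> colour r}).
Implicit Types (s : {perm coloured r n}).

Lemma card_colour : #|colour r| = r.
Proof. by rewrite card_ord prednK. Qed.

Lemma colour_lt_r c : (c < r)%N.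
Proof. by rewrite -[X in (_ < X)%N](prednK hr). Qed.

Lemma colour_addE c d : (c + d)%R = ((c + d) %% r)%N :> nat.
Proof. by congr (_ %% _)%N; exact: prednK. Qed.

Lemma colour_addr_eq0 c d : (c + d == 0) = (((c + d) %% r)%N == 0%N).
Proof. by rewrite -colour_addE. Qed.

(** The sum of the representatives is a multiple of [r] below [2r], and it is 0 only when both
    vanish. *)
Lemma colour_oppE c d : c + d == 0 -> (c + d = r * (c != 0%R))%N.
Proof.
rewrite colour_addr_eq0 => cd0; rewrite -(inj_eq val_inj) /=; move: cd0.
have := colour_lt_r c; have := colour_lt_r d => dr cr.
have [cdr|rcd] := ltnP (c + d) r; first by rewrite modn_small //; lia.
by rewrite -(subnK rcd) modnDr modn_small; lia.
Qed.

Lemma order2_colourE c : (c \in order2 _) = ((c : nat).*2 == r).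
Proof.
rewrite inE; apply/andP/eqP => [[c0 /colour_oppE]|cr].
  by rewrite c0 muln1 addnn.
split; last by rewrite colour_addr_eq0 addnn cr modnn.
by apply: contraTneq hr => c0; rewrite -cr c0.
Qed.

(** The only candidate is [r/2], available exactly for even [r]; the parity is read as 0 or 1. *)
Lemma card_order2_colour : #|order2 (colour r)| = ~~ odd r :> nat.
Proof.
have [ro|re] := boolP (odd r); last first.
  have hlt : (r./2 < r.-1.+1)%N by lia.
  rewrite -[RHS](cards1 (Ordinal hlt)); apply: eq_card => c.
  by rewrite order2_colourE inE -val_eqE /=; lia.
apply: eq_card0 => c; rewrite order2_colourE; apply: contraTF ro => /eqP <-.
by rewrite odd_double.
Qed.

(** The truncation in [r./2] is harmless: for odd [r] no fixed point is coloured. *)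
Lemma sum_alternating t z : (t ^+ 2 == 1)%g -> alternating t z ->
  (\sum_i (z i : nat) = r * #|[set i in ascents t | z i != 0%R]|
                        + r./2 * #|coloured_fixpoints t z|)%N.
Proof.
move=> t2 /forallP alt; have tt := involP t2.
rewrite (bigID (mem (ascents t))) /=.
rewrite [X in (_ + X)%N](bigID (fun i => t i == i)) /= addnA addnAC; congr (_ + _)%N.
  (* Reindexing by [t] moves the larger points onto their smaller partners, so the two colours of a
     cycle can be added. *)
  have -> : (\sum_(i | (i \notin ascents t) && (t i != i)) (z i : nat) =
             \sum_(i in ascents t) (z (t i) : nat))%N.
    rewrite (reindex_inj (@perm_inj _ t)); apply: eq_bigl => i.
    by rewrite !inE tt -val_eqE /=; lia.
  rewrite -big_split /= (eq_bigr (fun i => r * (z i != 0%R))%N) => [|i _]; last first.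
    exact: colour_oppE.
  rewrite -big_distrr -big_mkcondr /= sum1dep_card; congr (_ * _)%N.
rewrite (bigID (fun i => z i == 0)) /= big1 ?add0n => [|i /andP[_ /eqP ->]] //.
rewrite (eq_bigr (fun=> r./2)) => [|i /andP[/andP[_ /eqP ti] zi]]; last first.
  have : z i \in order2 _ by rewrite inE zi -[X in _ + z X]ti alt.
  by rewrite order2_colourE => /eqP zr; rewrite -[LHS]doubleK zr.
rewrite sum_nat_cond_const mulnC; congr (_ * _)%N; apply: eq_card => i.
rewrite !inE; case: eqP => [->|]; rewrite ?andbF //.
by rewrite ltnn.
Qed.

Definition coloured_map t z (x : coloured r n) : coloured r n :=
  (t x.1, x.2 + z x.1).

Lemma coloured_map_inj t z : injective (coloured_map t z).
Proof.
move=> [i c] [j d] e; have /perm_inj ij : t i = t j := congr1 fst e.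
by rewrite -ij in e *; have /addIr <- : c + z i = d + z i := congr1 snd e.
Qed.

Definition coloured_perm (u : {perm 'I_n} * {ffun 'I_n -> colour r}) :=
  perm (coloured_map_inj u.1 u.2).

Lemma coloured_permE t z i c :
  coloured_perm (t, z) (i, c) = (t i, c + z i).
Proof. by rewrite permE. Qed.

Lemma coloured_perm_inj : injective coloured_perm.
Proof.
move=> [t z] [t' z'] e.
have {}e i : (t i, 0 + z i) = (t' i, 0 + z' i) by rewrite -!coloured_permE e.
congr (_, _); first by apply/permP => i; exact: (congr1 fst (e i)).
by apply/ffunP => i; apply: (@addrI _ 0); exact: (congr1 snd (e i)).
Qed.

Lemma G_rnE : G_rn r n = [set coloured_perm u | u in setT].
Proof.
apply/setP => s; rewrite inE; apply/existsP/imsetP => [[t /existsP[z sE]]|].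
  exists (t, z); rewrite ?inE //; apply/permP => -[i c].
  by rewrite coloured_permE; move/forallP/(_ i)/forallP/(_ c)/eqP: sE.
case=> -[t z] _ ->; exists t; apply/existsP; exists z.
by apply/forallP => i; apply/forallP => c; rewrite coloured_permE.
Qed.

Lemma is_invol_coloured t z :
  is_invol (coloured_perm (t, z)) = (t ^+ 2 == 1)%g && alternating t z.
Proof.
apply/involP/andP => [ss|[/involP tt /forallP alt] [i c]]; last first.
  by rewrite !coloured_permE tt -addrA (eqP (alt i)) addr0.
have {}ss i : (t (t i), 0 + z i + z (t i)) = (i, 0).
  by rewrite -!coloured_permE ss.
split; first by apply/involP => i; exact: (congr1 fst (ss i)).
apply/forallP => i; rewrite -[z i]add0r; apply/eqP; exact: (congr1 snd (ss i)).
Qed.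

Lemma csum_coloured t z : csum (coloured_perm (t, z)) = (\sum_i (z i : nat))%N.
Proof. by apply: eq_bigr => i _; rewrite /colour_at coloured_permE add0r. Qed.

(** A nonzero colour puts the image below all uncoloured points, so only colour 0 gives an
    excedance; the bound [i.+1 < n] follows from [i < t i]. *)
Lemma exc_A_coloured t z :
  exc_A (coloured_perm (t, z)) = #|[set i in ascents t | z i == 0]|.
Proof.
apply: eq_card => i; rewrite !inE coloured_permE add0r /colour_lt /=.
rewrite eq_sym andbCA andbC; congr (_ && _); apply: andb_idl => it.
exact: leq_ltn_trans it (ltn_ord _).
Qed.

Lemma exc_Clr_coloured t z : (t ^+ 2 == 1)%g -> alternating t z ->
  exc_Clr (coloured_perm (t, z)) =
  (r * #|ascents t| + r./2 * #|coloured_fixpoints t z|)%N.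
Proof.
move=> t2 alt; rewrite /exc_Clr exc_A_coloured csum_coloured (sum_alternating t z) //.
rewrite addnA -mulnDr; congr (_ * _ + _)%N.
rewrite -[RHS](cardsID [set i | z i == 0]); congr (_ + _)%N; apply: eq_card => i.
  by rewrite !inE.
by rewrite !inE andbC.
Qed.

Lemma coloured_fixpoints_odd t z : (t ^+ 2 == 1)%g -> alternating t z ->
  odd r -> coloured_fixpoints t z = set0.
Proof.
move=> t2 /forallP alt ro; apply/setP => i; rewrite !inE.
apply: contraTF (ro) => /andP[/eqP ti zi].
have : z i \in order2 _ by rewrite inE zi -[X in _ + z X]ti alt.
by rewrite order2_colourE => /eqP <-; rewrite odd_double.
Qed.

(** The congruence modulo [p] holds automatically: [csum] is a multiple of [r] plus [r/2] per
    coloured fixed point, and these points are absent for odd [r]. *)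
Lemma invol_excE p m : (p %| r)%N -> odd r || (p %| r./2)%N ->
  invol_exc r p n m =
  [set coloured_perm u | u in
    [set u | [&& (u.1 ^+ 2 == 1)%g, alternating u.1 u.2
     & (r * #|ascents u.1| + r./2 * #|coloured_fixpoints u.1 u.2|)%N == m]]].
Proof.
move=> pr podd; apply/setP => s; rewrite inE [_ \in G_rpn _ _ _]inE.
apply/idP/imsetP => [|[[t z]]].
  rewrite G_rnE => /andP[/andP[/imsetP[[t z] _ ->] _]].
  rewrite is_invol_coloured => /andP[/andP[t2 alt]].
  by rewrite exc_Clr_coloured // => em; exists (t, z); rewrite ?inE ?t2 ?alt.
rewrite inE /= => /and3P[t2 alt em] ->.
rewrite is_invol_coloured exc_Clr_coloured // t2 alt em !andbT.
rewrite G_rnE imset_f // mod0n csum_coloured (sum_alternating t z) //=.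
apply: dvdn_add; first exact: dvdn_mulr.
case/orP: podd => [ro|ph]; last exact: dvdn_mulr.
by rewrite coloured_fixpoints_odd // cards0 muln0.
Qed.

(** Here [l] is the number of 2-cycles and [f] that of coloured fixed points; both are sizes of
    subsets of ['I_n], hence the ranges. *)
Lemma card_invol_exc p m : (p %| r)%N -> odd r || (p %| r./2)%N ->
  #|invol_exc r p n m| =
  (\sum_(l < n.+1) \sum_(f < n.+1 | r * l + r./2 * f == m)
     #|@involutions 'I_n l.*2| * (r ^ l * ('C(n - l.*2, f) * (~~ odd r) ^ f)))%N.
Proof.
move=> pr podd; rewrite invol_excE // card_imset; last exact: coloured_perm_inj.
pose F t := [set z : {ffun 'I_n -> colour r} | alternating t z &
  (r * #|ascents t| + r./2 * #|coloured_fixpoints t z| == m)%N].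
pose I := [set t : {perm 'I_n} | (t ^+ 2 == 1)%g].
have -> : [set u : {perm 'I_n} * {ffun 'I_n -> colour r} |
            [&& (u.1 ^+ 2 == 1)%g, alternating u.1 u.2
     & (r * #|ascents u.1| + r./2 * #|coloured_fixpoints u.1 u.2|)%N == m]]
  = [set u | (u.1 \in I) && (u.2 \in F u.1)] by apply/setP => u; rewrite !inE.
have card_le (S : {set 'I_n}) : (#|S| < n.+1)%N.
  by rewrite ltnS -[X in (_ <= X)%N](card_ord n) max_card.
rewrite card_sigma_set.
rewrite (partition_big (fun t => Ordinal (card_le (ascents t))) xpredT) //=.
apply: eq_bigr => l _.
rewrite (eq_bigr (fun=> \sum_(f < n.+1 | r * l + r./2 * f == m)
     (r ^ l * ('C(n - l.*2, f) * (~~ odd r) ^ f)))%N).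
  rewrite sum_nat_cond_const -[RHS]big_distrr /=; congr (_ * _)%N.
  apply: eq_card => t; rewrite !inE; apply: andb_id2l => t2.
  rewrite -val_eqE /= card_displaced_ascents // -!muln2 eqn_mul2r //.
move=> t /andP[]; rewrite inE => t2 /eqP lE.
have {}lE : #|ascents t| = l by rewrite -lE.
rewrite -sum1_card (partition_big
  (fun z : {ffun 'I_n -> colour r} => Ordinal (card_le (coloured_fixpoints t z)))
  (fun f : 'I_n.+1 => r * l + r./2 * f == m)%N) /=; last first.
  by move=> z; rewrite inE lE => /andP[].
apply: eq_bigr => f fm.
have := card_alternating_draws (colour r) t2 f.
rewrite lE card_order2_colour card_colour => <-.
rewrite -sum1_card; apply: eq_bigl => z; rewrite !inE -andbA -val_eqE /= lE.
by congr (_ && _); apply: andb_idl => /eqP ->.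
Qed.

End ColouredInvolutions.

(** * From natural-number counts to multinomial formulas *)

Lemma card_involutions_gt (n l : nat) :
  (n < l.*2)%N -> #|@involutions 'I_n l.*2| = 0%N.
Proof.
move=> nl; apply: eq_card0 => t; rewrite !inE; apply/andP => -[_ /eqP td].
by have := max_card (displaced t); rewrite td card_ord leqNgt nl.
Qed.

Lemma fact_neq0 (n : nat) : n`!%:R != 0 :> rat.
Proof. by rewrite pnatr_eq0 -lt0n fact_gt0. Qed.

Lemma card_involutions_rat (n l : nat) : (l.*2 <= n)%N ->
  #|@involutions 'I_n l.*2|%:R
  = n`!%:R / (2 ^+ l * l`!%:R * (n - l.*2)`!%:R) :> rat.
Proof.
move=> ln; have := @card_involutions 'I_n l; rewrite card_ord => /(_ ln) <-.
rewrite !natrM natrX mulfK // !mulf_neq0 ?expf_neq0 ?fact_neq0 //.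
Qed.

Lemma multinom_nat (n : nat) (s : seq nat) :
  multinom n [seq a%:R | a <- s] = n`!%:R / \prod_(a <- s) a`!%:R.
Proof.
rewrite /multinom big_map ifT; last by apply/allP => _ /mapP[a _ ->].
by congr (_ / _); apply: eq_bigr => a _; rewrite natrK.
Qed.

Lemma multinom_eq0 (n : nat) (s : seq rat) (x : rat) :
  x \in s -> x \isn't a Num.nat -> multinom n s = 0.
Proof.
by move=> xs xn; rewrite /multinom ifF //; apply: contraNF xn => /allP ->.
Qed.

Lemma card_invol_exc_odd (r p n m : nat) : (0 < r)%N -> (p %| r)%N -> odd r ->
  #|invol_exc r p n m|
  = (\sum_(l < n.+1 | r * l == m) #|@involutions 'I_n l.*2| * r ^ l)%N.
Proof.
move=> hr pr ro; rewrite card_invol_exc ?ro // [RHS]big_mkcond.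
(* For odd [r] the factor is [0 ^ f], so only [f = 0] survives. *)
apply: eq_bigr => l _; rewrite big_mkcond big_ord_recl /= big1 => [|f _].
  by rewrite muln0 !addn0 bin0 !muln1.
by rewrite exp0n // !muln0; case: ifP.
Qed.

Lemma natr_div_nat (r m : nat) : (0 < r)%N ->
  ((m%:R / r%:R : rat) \is a Num.nat) = (r %| m)%N.
Proof.
move=> hr; have r0 : r%:R != 0 :> rat by rewrite pnatr_eq0 -lt0n.
apply/idP/idP => [/natrP[a ma]|]; last exact: Qnat_dvd.
apply/dvdnP; exists a; apply/eqP; rewrite -(eqr_nat rat) natrM -ma.
by rewrite divfK.
Qed.

(** With [r = 2h], the equation [2hl + hf = m] forces [f = 2k - 2l], the last multinomial entry, so
    the sum has at most one nonzero term. *)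
Lemma card_invol_exc_even_rat (h p n m l : nat) (k := m%:R / (h.*2)%:R : rat) :
  (0 < h)%N -> (l.*2 <= n)%N ->
  (\sum_(f < n.+1 | h.*2 * l + h * f == m)
     #|@involutions 'I_n l.*2| * (h.*2 ^ l * 'C(n - l.*2, f)))%N%:R
  = l`!%:R * multinom n [:: l%:R; l%:R; n%:R - 2 * k; 2 * k - 2 * l%:R]
      * (h.*2%:R / 2) ^+ l :> rat.
Proof.
move=> h0 ln; have hn0 : h%:R != 0 :> rat by rewrite pnatr_eq0 -lt0n.
have k2 : 2 * k = m%:R / h%:R by rewrite /k -mul2n natrM; field.
(* Any solution satisfies [f <= m] because [h > 0]. If there is none, [2k - 2l] is not a natural
   number and both sides vanish. *)
have [|nhm] := boolP [exists f : 'I_m.+1, h.*2 * l + h * f == m]%N; last first.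
  rewrite big_pred0 => [|f].
    rewrite (@multinom_eq0 _ _ (2 * k - 2 * l%:R)) ?mulr0 ?mul0r ?inE ?eqxx ?orbT //.
    apply: contra nhm => /natrP[f fE]; have fm : m = (h.*2 * l + h * f)%N.
      apply/eqP; rewrite -(eqr_nat rat) natrD !natrM -fE k2 -mul2n natrM.
      by apply/eqP; field.
    have fm' : (f < m.+1)%N by rewrite fm; nia.
    by apply/existsP; exists (Ordinal fm') => /=; rewrite -fm.
  apply: contraNF nhm => fm; have fm' : (f < m.+1)%N by rewrite -(eqP fm); nia.
  by apply/existsP; exists (Ordinal fm').
case/existsP => -[f /= _] /eqP fm.
have {}k2 : 2 * k = (l.*2 + f)%:R.
  by rewrite k2 -fm -muln2 natrD !natrM natrD -muln2 natrM; field.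
have fE (f' : nat) : (h.*2 * l + h * f' == m)%N = (f' == f).
  by rewrite -fm eqn_add2l eqn_pmul2l.
rewrite k2 (eq_bigl (fun f' : 'I_n.+1 => f' == f :> nat)) => [|f']; last exact: fE.
(* With too few fixed points, the binomial vanishes on one side and [n - 2k] is negative on the
   other. *)
have [fn|nf] := leqP f (n - l.*2); last first.
  rewrite big1 => [|f' /eqP ->]; last by rewrite bin_small // !muln0.
  rewrite (@multinom_eq0 _ _ (n%:R - (l.*2 + f)%:R)) ?mulr0 ?mul0r ?inE ?eqxx ?orbT //.
  apply/negP => /natr_ge0; rewrite subr_ge0 ler_nat; lia.
have fn' : (f < n.+1)%N by lia.
rewrite (big_pred1 (Ordinal fn')) => [/=|f'] //.
have -> : [:: l%:R; l%:R; n%:R - (l.*2 + f)%:R; (l.*2 + f)%:R - 2 * l%:R]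
          = [seq a%:R | a <- [:: l; l; n - l.*2 - f; f]%N] :> seq rat.
  rewrite /= -subnDA natrB; last by lia.
  by congr [:: _; _; _; _]; rewrite -mul2n natrD natrM; ring.
rewrite multinom_nat !big_cons big_nil !natrM card_involutions_rat //.
rewrite -(bin_fact fn) !natrM natrX expr_div_n.
by field; rewrite expf_neq0 // !fact_neq0 pnatr_eq0 -lt0n bin_gt0 fn.
Qed.

(* The truncation of k is used only where k is a natural number: otherwise the
   multinomial coefficient, hence the whole product, is 0. *)
Theorem theorem1p1 (r p n m : nat) (hr : (0 < r)%N) (hp : (0 < p)%N)
    (hn : (0 < n)%N) (hpr : (p %| r)%N) :
  let k : rat := m%:R / r%:R in
  (odd r ->
     #|invol_exc r p n m|%:R =
       (Num.truncn k)`!%:R * multinom n [:: k; k; n%:R - 2 * k]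
         * (r%:R / 2) ^+ Num.truncn k)
  /\
  (~~ odd r -> (p %| r %/ 2)%N ->
     #|invol_exc r p n m|%:R =
       \sum_(uphalf n <= j < n.+1)
         (n - j)`!%:R
           * multinom n [:: n%:R - j%:R; n%:R - j%:R; n%:R - 2 * k;
                            2 * k - 2 * n%:R + 2 * j%:R]
           * (r%:R / 2) ^+ (n - j)).
Proof.
move=> k; split=> [ro|re ph].
  rewrite card_invol_exc_odd //.
  have [rm|rm] := boolP (r %| m)%N; last first.
    rewrite big_pred0 => [|l].
      rewrite (@multinom_eq0 _ _ k) ?mulr0 ?mul0r ?inE ?eqxx //.
      by rewrite natr_div_nat.
    by apply: contraNF rm => /eqP <-; rewrite dvdn_mulr.
  have kE : k = (m %/ r)%:R.
    by rewrite /k -{1}(divnK rm) natrM mulfK // pnatr_eq0 -lt0n.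
  set q := (m %/ r)%N in kE.
  have qE (l : nat) : (r * l == m)%N = (l == q).
    by rewrite -(divnK rm) mulnC eqn_pmul2r.
  rewrite (eq_bigl (fun l : 'I_n.+1 => l == q :> nat)) => [|l]; last exact: qE.
  (* If [2q > n], there are no involutions with [q] 2-cycles, and [n - 2k] is negative. *)
  rewrite kE natrK; have [qn|nq] := leqP q.*2 n; last first.
    rewrite big1 => [|l /eqP ->]; last by rewrite card_involutions_gt.
    rewrite (@multinom_eq0 _ _ (n%:R - 2 * q%:R)) ?mulr0 ?mul0r ?inE ?eqxx ?orbT //.
    by apply/negP => /natr_ge0; rewrite subr_ge0 -natrM ler_nat mul2n leqNgt nq.
  have qn' : (q < n.+1)%N by lia.
  rewrite (big_pred1 (Ordinal qn')) => [/=|l] //.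
  have -> : [:: q%:R; q%:R; n%:R - 2 * q%:R]
            = [seq a%:R | a <- [:: q; q; n - q.*2]%N] :> seq rat.
    by rewrite /= natrB // -mul2n natrM.
  rewrite multinom_nat !big_cons big_nil natrM card_involutions_rat //.
  by rewrite natrX expr_div_n; field; rewrite ?expf_neq0 ?fact_neq0.
have rE : r = r./2.*2 by lia.
have ph' : (p %| r./2)%N by rewrite -divn2.
rewrite card_invol_exc ?ph' ?orbT // (negbTE re) /=.
(* Shifting and reversing the sum replaces [j] by [l = n - j], the number of 2-cycles, running from
   0 to [n./2]. *)
rewrite -[uphalf n]add0n big_addn big_nat_rev /= add0n.
have -> : (n.+1 - uphalf n = n./2.+1)%N by lia.
rewrite (eq_bigr (fun l : 'I_n.+1 => \sum_(f < n.+1 | r * l + r./2 * f == m)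
    #|@involutions 'I_n l.*2| * (r ^ l * 'C(n - l.*2, f)))%N); last first.
  by move=> l _; apply: eq_bigr => f _; rewrite exp1n muln1.
rewrite -(big_mkord xpredT (fun l => \sum_(f < n.+1 | r * l + r./2 * f == m)
    #|@involutions 'I_n l.*2| * (r ^ l * 'C(n - l.*2, f)))%N).
(* The terms with [l > n./2] are split off; they vanish for lack of points. *)
rewrite (@big_cat_nat _ _ _ n./2.+1) //=; last by lia.
rewrite [X in (_ + X)%N]big_nat_cond [X in (_ + X)%N]big1 => [|l]; last first.
  by move=> ?; apply: big1 => f _; rewrite card_involutions_gt //; lia.
rewrite addn0 natr_sum; apply: eq_big_nat => l /= ln.
have jE : (n./2.+1 - l.+1 + uphalf n = n - l)%N by lia.
have nlE : n%:R - (n - l)%:R = l%:R :> rat by rewrite natrB; [ring | lia].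
rewrite jE nlE (_ : (n - (n - l) = l)%N); last by lia.
rewrite (_ : _ - 2 * n%:R + _ = 2 * k - 2 * l%:R); last by rewrite -nlE; ring.
rewrite /k; move: (r./2) rE => h rE; rewrite rE card_invol_exc_even_rat //; lia.
Qed.
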